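(* Let $\Delta=[-\frac{\pi}{2},\frac{\pi}{2}]$ and let $f\in H^1_0(\Delta)$. Then $$2\Big(\int_{-\pi/2}^{\pi/2}f(x)\,dx\Big)^2-\pi\int_{-\pi/2}^{\pi/2}\big(f(x)^2-f'(x)^2\big)\,dx\;\geq\;0,$$ and equality holds only when $f=0$. In other words, the bilinear form $\langle\cdot,\cdot\rangle_i$ defined below is positive definite on $H^1_0(\Delta)$.
   Context: $H^1(\Delta)$ denotes the space of absolutely continuous functions $f:\Delta\to\mathbb{R}$ whose (a.e. defined) derivative $f'$ lies in $L_2(\Delta)$. $H^1_0(\Delta)$ is the subspace of those $f\in H^1(\Delta)$ with $f(-\frac{\pi}{2})=f(\frac{\pi}{2})$. For $f,g\in H^1_0(\Delta)$ the bilinear form is $$\langle f,g\rangle_i=\frac{1}{\pi^2}\Big[2\Big(\int_{-\pi/2}^{\pi/2}f\Big)\Big(\int_{-\pi/2}^{\pi/2}g\Big)-\pi\int_{-\pi/2}^{\pi/2}\big(fg-f'g'\big)\Big].$$ *)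

(* Defs.v *)
From HB Require Import structures.
From mathcomp Require Import all_boot all_order all_algebra.
From mathcomp Require Import all_classical all_reals all_analysis.
Set Implicit Arguments. Unset Strict Implicit. Unset Printing Implicit Defensive.
Import Order.TTheory GRing.Theory Num.Theory.
Import numFieldNormedType.Exports.
Local Open Scope classical_set_scope.
Local Open Scope ring_scope.

Definition Delta (R : realType) : set R := `[- (pi / 2), pi / 2]%classic.

Arguments Delta : clear implicits.

Definition abs_cont_on (R : realType) (a b : R) (f : R -> R) : Prop :=
  forall e : R, 0 < e -> exists2 d : R, 0 < d &
    forall (n : nat) (u v : nat -> R),
      (forall k, (k < n)%N -> a <= u k /\ u k <= v k /\ v k <= b) ->
      (forall i j, (i < n)%N -> (j < n)%N -> i <> j ->
          v i <= u j \/ v j <= u i) ->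
      \sum_(k < n) (v k - u k) < d ->
      \sum_(k < n) `|f (v k) - f (u k)| < e.

Definition H1_with_deriv (R : realType) (f f' : R -> R) : Prop :=
  abs_cont_on (- (pi / 2)) (pi / 2) f /\
  measurable_fun (Delta R) f' /\
  (lebesgue_measure : set R -> \bar R).-integrable (Delta R)
     (fun x => ((f' x) ^+ 2)%:E) /\
  {ae (lebesgue_measure : set R -> \bar R),
     forall x, Delta R x -> is_derive x 1 f (f' x)}.

Definition H1_0_with_deriv (R : realType) (f f' : R -> R) : Prop :=
  H1_with_deriv f f' /\ f (- (pi / 2)) = f (pi / 2).

Definition form_i_bracket (R : realType) (f f' g g' : R -> R) : R :=
  2 * (Rintegral lebesgue_measure (Delta R) f) *
      (Rintegral lebesgue_measure (Delta R) g)
  - pi * Rintegral lebesgue_measure (Delta R) (fun x => f x * g x - f' x * g' x).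

Definition form_i (R : realType) (f f' g g' : R -> R) : R :=
  (pi ^+ 2)^-1 * form_i_bracket f f' g g'.

(* Main.v *)
Require Import Defs.
From HB Require Import structures.
From mathcomp Require Import all_boot all_order all_algebra.
From mathcomp Require Import ring lra.
From mathcomp Require Import all_classical all_reals all_analysis measurable_realfun.
Import Order.TTheory GRing.Theory Num.Theory.
Import numFieldNormedType.Exports.
Local Open Scope classical_set_scope.
Local Open Scope ring_scope.

(* For [x < y] in [Delta], Cauchy-Schwarz on each of the two arcs of the circle
   of length [pi] gives, with [t = y - x] and [E] the integral of [f'^2],
   [pi (f y - f x)^2 <= t (pi - t) E]. Integrating in [x] bounds the integral of
   [(f - f y)^2] by [pi^2 E / 6]. If [m] is the mean of [f] and [y] maximises
   [(f - m)^2], that integral is at least [2 G], where [G] is the integral of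
   [(f - m)^2]; hence [G <= pi^2 E / 12]. The expression to be bounded is
   [(pi m)^2 + pi (E - G) >= (pi m)^2 + pi (1 - pi^2 / 12) E] and [pi^2 < 12], so
   it is nonnegative, and if it vanishes then [E = m = 0]. The increments of an
   absolutely continuous [f] are controlled by [f'] through a comparison with a
   monotone [F] such that [|f'| <= F'] almost everywhere. *)

(** * Increments of absolutely continuous functions *)

(** The step at the supremum of the points satisfying [P] carries [P] from just left of it to a
    point beyond it, unless the supremum is [b]. Requiring [u <= t <= v] lets the step use local
    information at [t] alone. *)
Lemma straddle_induction (R : realType) (a b : R) (P : R -> Prop) :
  a <= b -> P a ->
  (forall t, a <= t <= b -> exists2 d, 0 < d & forall u v,
     a <= u -> u <= t -> t <= v -> v <= b -> t - d < u -> v < t + d ->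
     P u -> P v) ->
  P b.
Proof.
move=> ab Pa step.
pose S := [set x : R | a <= x <= b /\ P x].
have Sa : S a by split => //; rewrite lexx ab.
have ubS : ubound S b by move=> x [/andP[]].
have supS : has_sup S by split; [exists a | exists b].
have aS : a <= sup S by apply: ub_le_sup => //; exists b.
have Sb : sup S <= b by apply: ge_sup => //; exists a.
have [|d d0 dP] := step (sup S); first by rewrite aS.
have [u [/andP[au ub] Pu] du] := sup_adherent d0 supS.
have uS : u <= sup S by apply: ub_le_sup => //; [exists b | split; rewrite ?au].
pose v := Num.min b (sup S + d / 2).
have Sv : sup S <= v by rewrite le_min Sb lerDl; lra.
have vb : v <= b by rewrite ge_min lexx.
have Pv : P v.
  apply: (dP u) => //; rewrite /v gt_min; apply/orP; right; lra.
have : v <= sup S.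
  by apply: ub_le_sup => //; [exists b | split=> //; rewrite vb (le_trans aS)].
rewrite ge_min => /orP[bS|]; last by lra.
by have <- : v = b by apply/eqP; rewrite eq_le vb (le_trans bS).
Qed.

(** The errors on the two sides of [t] add up to the right bound because
    [(v - t) + (t - u) = v - u]; this is where [u <= t <= v] matters. *)
Lemma is_derive_straddle {R : realType} {f : R -> R} {t l e : R} :
  is_derive t 1 f l -> 0 < e ->
  exists2 d, 0 < d & forall u v, u <= t -> t <= v -> t - d < u -> v < t + d ->
    `|f v - f u - l * (v - u)| <= e * (v - u).
Proof.
move=> [dft fl] e0.
have : h^-1 *: (f (h *: 1 + t) - f t) @[h --> 0^'] --> l by rewrite -fl.
move=> /cvgrPdist_le /(_ _ e0)[d /= d0 dP].
have side w : t - d < w -> w < t + d ->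
    `|f w - f t - l * (w - t)| <= e * `|w - t|.
  move=> tw wt; have [->|wNt] := eqVneq w t.
    by rewrite !subrr mulr0 subr0 normr0 mulr0.
  have wt0 : w - t != 0 by rewrite subr_eq0.
  have := dP (w - t); rewrite /= sub0r normrN ltr_norml => /(_ _ wt0).
  rewrite -[_ *: 1]/((w - t) * 1) mulr1 subrK => /(_ _)/wrap[]; first by lra.
  move=> H.
  rewrite -ler_pdivrMr ?normr_gt0// -normfV -normrM distrC in H *.
  apply: le_trans H; rewrite le_eqVlt; apply/orP; left; apply/eqP.
  by congr (`|_|); rewrite -[_ *: _]/(_ * _); field.
exists d => // u v ut tv tu vt.
have := side u tu (le_lt_trans ut _); have := side v (lt_le_trans _ tv) vt.
rewrite (ger0_norm (_ : 0 <= v - t)) ?subr_ge0//.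
rewrite (ler0_norm (_ : u - t <= 0)) ?subr_le0//.
move=> /(_ ltac:(lra)); rewrite ler_norml => /andP[v1 v2].
move=> /(_ ltac:(lra)); rewrite ler_norml => /andP[u1 u2].
by rewrite ler_norml; apply/andP; split; lra.
Qed.

(** Off a null set the derivatives compare short increments of [f] and [F]; the null set is enclosed
    in an open set so small that absolute continuity makes the variation of [f] there negligible. *)
Lemma abs_cont_comparison (R : realType) (a b : R) (f F : R -> R) :
  a <= b -> abs_cont_on a b f ->
  (forall x y, a <= x -> x <= y -> y <= b -> F x <= F y) ->
  {ae lebesgue_measure, forall t, a <= t <= b ->
     exists l L, [/\ is_derive t 1 f l, is_derive t 1 F L & `|l| <= L]} ->
  `|f b - f a| <= F b - F a.
Proof.
move=> ab acf Fmono [N [mN muN0 HN]].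
pose mu : {measure set (measurableTypeR R) -> \bar R} := @lebesgue_measure R.
have N0 : mu N = 0%E by exact: muN0.
have Noo : (mu N < +oo)%E by rewrite N0.
have der t : a <= t <= b -> ~ N t ->
    exists l L, [/\ is_derive t 1 f l, is_derive t 1 F L & `|l| <= L].
  by move=> tab Nt; apply: contrapT => H; apply/Nt/HN => /= /(_ tab).
apply/ler_addgt0Pl => e0 e0_gt0.
(* Chosen so that [e + 2 * e * (b - a) = e0]: one [e] for the variation inside [U], and
   [e * (b - a)] for each of the linearisation errors of [f] and [F]. *)
pose e := e0 / (1 + 2 * (b - a)).
have den : 0 < 1 + 2 * (b - a) by lra.
have e_gt0 : 0 < e by rewrite divr_gt0.
have [d d_gt0 dP] := acf e e_gt0.
have [U [oU NU muU]] := lebesgue_regularity_outer mN Noo d_gt0.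
have mU : measurable U by exact: open_measurable.
have {}muU : (mu U < d%:E)%E.
  have -> : (mu U = mu N + mu (U `\` N))%E.
    by rewrite -measureU ?setDUK ?setDIK//; exact: measurableD.
  by rewrite N0 add0e.
(* [P x]: the increment of [f] on [[a, x]] is controlled by that of [F], up to
   the variation over finitely many disjoint intervals inside [U]; the latter is
   small at the end because [U] has small measure. *)
pose P x := exists n (u v : nat -> R),
  [/\ forall k, (k < n)%N -> a <= u k /\ u k <= v k /\ v k <= x,
   forall i j, (i < n)%N -> (j < n)%N -> i <> j -> v i <= u j \/ v j <= u i,
   ((\sum_(k < n) (v k - u k))%:E <= mu (U `&` `]a, x]))%E &
   `|f x - f a| <= F x - F a + 2 * e * (x - a)
                    + \sum_(k < n) `|f (v k) - f (u k)|].
suff [n [u [v [uv disj suv Hf]]]] : P b.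
  have : \sum_(k < n) `|f (v k) - f (u k)| < e.
    apply: dP => //; rewrite -lte_fin (le_lt_trans suv)// (le_lt_trans _ muU)//.
    by apply: le_measure; rewrite ?inE//; exact: measurableI.
  have -> : e0 = e + 2 * e * (b - a) by rewrite /e; field; lra.
  lra.
apply: (@straddle_induction _ a) => //.
  exists 0%N, (fun=> 0), (fun=> 0); split => //; rewrite ?big_ord0 ?subrr//.
  by rewrite normr0 mulr0.
(* Around a point of [N] the interval [[x, y]] lies in [U] and is appended to the family;
   monotonicity of [F] does the rest. *)
move=> t tab; have [Nt|Nt] := pselect (N t).
  have /= /nbhs_ballP[r /= r0 rU] : nbhs t U by apply: open_nbhs_nbhs; split => //; exact: NU.
  exists r => // x y ax xt ty yb tx yt [n [u [v [uv disj suv Hf]]]].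
  exists n.+1, (fun k => if (k < n)%N then u k else x),
               (fun k => if (k < n)%N then v k else y).
  have xy : x <= y by exact: le_trans ty.
  have E (g : R -> R -> R) : \sum_(k < n.+1) g (if (k < n)%N then v k else y)
        (if (k < n)%N then u k else x) = \sum_(k < n) g (v k) (u k) + g y x.
    rewrite big_ord_recr /= ltnn; congr (_ + _).
    by apply: eq_bigr => i _; rewrite ltn_ord.
  split.
  - move=> k _; case: ifPn => [/uv[? [? ?]]|_]; last by [].
    by split => //; split => //; exact: le_trans xy.
  - move=> i j; rewrite !ltnS => iln jln ij.
    case: ifPn => [iltn|]; case: ifPn => [jltn|]; first exact: disj.
    + by left; have [_ []] := uv _ iltn.
    + by right; have [_ []] := uv _ jltn.
    + rewrite -!leqNgt => nj ni; exfalso; apply: ij.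
      by apply/eqP; rewrite eqn_leq (leq_trans iln nj) (leq_trans jln ni).
  - rewrite (E (fun p q => p - q)) EFinD.
    have mxy : measurable `]x, y]%classic by exact: measurable_itv.
    have -> : (y - x)%:E = mu `]x, y]%classic.
      have := lebesgue_measure_itv `]x, y]; rewrite /= lte_fin => ->; case: ltP => //.
      by move=> yx; rewrite (@le_anti _ _ x y) ?xy// subrr.
    apply: (le_trans (leeD2r _ suv)).
    rewrite -measureU//; last 2 first.
      exact: measurableI.
      rewrite -subset0 => z [[_ /=]]; rewrite !in_itv/=.
      by move=> /andP[_ zx] /andP[/lt_le_trans/(_ zx)]; rewrite ltxx.
    apply: le_measure; rewrite ?inE.
    + by apply: measurableU => //; exact: measurableI.
    + exact: measurableI.
    + move=> z [[Uz]|]; rewrite /= !in_itv/= => /andP[z1 z2]; split => //=.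
      * by rewrite ?in_itv/= z1 (le_trans z2).
      * by apply: rU; rewrite /ball/= ltr_norml; apply/andP; split; lra.
      * by rewrite ?in_itv/= z2 (le_lt_trans ax).
  - rewrite (E (fun p q => `|f p - f q|)).
    have := ler_distD (f x) (f y) (f a).
    have := Fmono x y ax xy yb.
    have : e * (x - a) <= e * (y - a) by rewrite ler_pM2l// lerD2r.
    by lra.
(* Outside [N] the family is unchanged, and the two derivatives control the increment over
   [[x, y]]. *)
have [l [L [dl dL lL]]] := der t tab Nt.
have [d1 d1_gt0 d1P] := is_derive_straddle dl e_gt0.
have [d2 d2_gt0 d2P] := is_derive_straddle dL e_gt0.
exists (Num.min d1 d2); first by rewrite lt_min d1_gt0.
move=> x y ax xt ty yb tx yt [n [u [v [uv disj suv Hf]]]].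
have xy : x <= y by exact: le_trans ty.
have [tx1 tx2] : t - d1 < x /\ t - d2 < x.
  by move: tx; rewrite ltrBlDr -ltrBlDl lt_min => /andP[]; lra.
have [yt1 yt2] : y < t + d1 /\ y < t + d2.
  by move: yt; rewrite -ltrBlDl lt_min => /andP[]; lra.
have := d1P x y xt ty tx1 yt1.
have := d2P x y xt ty tx2 yt2; rewrite ler_norml => /andP[FL _] fl.
exists n, u, v; split => //.
- by move=> k /uv[? [? ?]]; split => //; split => //; exact: le_trans xy.
- apply: (le_trans suv); apply: le_measure; rewrite ?inE; [exact: measurableI..|].
  move=> z [Uz]; rewrite /= !in_itv/= => /andP[z1 z2]; split => //=.
  by rewrite ?in_itv/= z1 (le_trans z2).
- have lL' : `|l * (y - x)| <= L * (y - x).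
    by rewrite normrM (ger0_norm (_ : 0 <= y - x)) ?subr_ge0// ler_wpM2r// subr_ge0.
  have : `|f y - f x| <= e * (y - x) + L * (y - x).
    rewrite -[f y - f x](subrK (l * (y - x))).
    by apply: (le_trans (ler_normD _ _)); exact: lerD.
  have := ler_distD (f x) (f y) (f a).
  by lra.
Qed.

Lemma abs_cont_onS {R : realType} {a b : R} {f : R -> R} (c d : R) :
  a <= c -> d <= b -> abs_cont_on a b f -> abs_cont_on c d f.
Proof.
move=> ac db acf e /acf[r r0 rP]; exists r => // n u v uv.
apply: rP => k /uv[cu [-> vd]].
by rewrite (le_trans ac)// (le_trans vd).
Qed.

Lemma abs_cont_on_continuous (R : realType) (a b : R) (f : R -> R) :
  abs_cont_on a b f -> {within `[a, b], continuous f}.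
Proof.
move=> acf; apply/subspace_continuousP => x /=; rewrite in_itv/= => /andP[ax xb].
apply/cvgrPdist_lt => e e0; have [r r0 rP] := acf e e0.
near_simpl; rewrite near_withinE /=; near=> y.
rewrite in_itv/= => /andP[ay yb].
have xyr : `|x - y| < r by near: y; exact: nbhsx_ballx.
pose u := Num.min x y; pose v := Num.max x y.
have uv : u <= v by rewrite /u /v ge_min le_max lexx.
have := rP 1%N (fun=> u) (fun=> v).
rewrite !big_ord1.
have -> : v - u = `|x - y| by rewrite /u /v; case: (lerP x y) => ?; rewrite ?subrr //; lra.
have -> : `|f v - f u| = `|f x - f y|.
  by rewrite /u /v; case: (lerP x y) => ? //; rewrite distrC.
apply => //.
- by move=> _ _; rewrite uv /u /v le_min ax ay ge_max xb yb.
- by move=> [|i] [|j].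
Unshelve. all: by end_near. Qed.

(** * Transfer of integrability, a bound on [pi], and polynomial integrals *)

(* The hypotheses of the theorem use the measurable structure of [R] with the
   default display, the library's integrals on [R] the one of [measurableTypeR R];
   the measurable sets are the same but the two displays are not convertible. *)
Lemma lebesgue_integrable_sigma (R : realType) (D : set R) (f : R -> \bar R) :
  measurable D ->
  (lebesgue_measure : set R -> \bar R).-integrable D f ->
  lebesgue_measure.-integrable D f.
Proof.
move=> mD /integrableP[mf foo].
have mf' : measurable_fun (D : set (measurableTypeR R)) f by exact: mf.
apply/integrableP; split => //.
(* The identity is measurable between the two structures, so pushforward along it transports the
   integral. *)
pose phi : measurableTypeR R -> R := id.
have mphi : measurable_fun [set: measurableTypeR R] phi by exact: measurable_id.
have := @ge0_integral_pushforward _ _ _ _ _ _ mphi (@lebesgue_measure R) D (fun x => `|f x|%E) mD.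
move=> <- //; exact: measurableT_comp.
Qed.

(* This is [tan x > x] at [x = pi / 6], where [tan x = 1 / sqrt 3]. *)
Lemma pi_sqr_lt12 (R : realType) : (pi : R) ^+ 2 < 12.
Proof.
pose x : R := pi / 6.
have pi0 := @pi_gt0 R.
have x0 : 0 < x by rewrite divr_gt0.
have c0 : 0 < cos x by apply: cos_gt0_pihalf; rewrite /x; apply/andP; split; lra.
have cs : x * cos x < sin x.
  (* [tan y > y] without division: [g 0 = 0] and [g' y = y * sin y > 0]. *)
  pose g y : R := sin y - y * cos y.
  have dg (y : R) : is_derive y 1 g (y * sin y).
    rewrite /g; apply: is_derive_eq.
    by rewrite -![_ *: _]/(_ * _); ring.
  have cg : {within `[0, x], continuous g}.
    apply: derivable_within_continuous => y _; by have [] := dg y.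
  have [y yx] := MVT x0 (fun y _ => dg y) cg.
  rewrite /g mul0r sin0 !subr0 => E.
  rewrite -subr_gt0 E; move: yx; rewrite in_itv/= => /andP[y0 yx].
  rewrite !mulr_gt0//; apply: sin_gt0_pihalf; rewrite y0 /=.
  by move: yx; rewrite /x; lra.
(* From the triple angle formula, since [3 * x = pi / 2]. *)
have c3 : cos x ^+ 2 = 3 / 4.
  have : cos (x *+ 2 + x) = 0.
    by rewrite -(@cos_pihalf R); congr cos; rewrite /x mulr2n; lra.
  rewrite cosD sin_mulr2n cos_mulr2n => H.
  have : cos x * (4 * cos x ^+ 2 - 3) = 0.
    have : cos x * (cos x ^+ 2 + sin x ^+ 2) = cos x by rewrite cos2Dsin2 mulr1.
    lra.
  move/eqP; rewrite mulf_eq0 gt_eqF//= => /eqP; lra.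
have s3 : sin x ^+ 2 = 1 / 4 by have := cos2Dsin2 x; lra.
have : (x * cos x) ^+ 2 < sin x ^+ 2.
  by rewrite ltrXn2r// mulr_ge0// ltW.
rewrite exprMn c3 s3 /x.
have -> : (pi / 6 : R) ^+ 2 * (3 / 4) = pi ^+ 2 / 48 by field.
lra.
Qed.

Lemma Rintegral_quadratic (R : realType) (a b p q r : R) : a <= b ->
  \int[lebesgue_measure]_(x in `[a, b]) (p + q * x + r * x ^+ 2) =
  p * (b - a) + q * (b ^+ 2 - a ^+ 2) / 2 + r * (b ^+ 3 - a ^+ 3) / 3.
Proof.
rewrite le_eqVlt => /predU1P[<-|ab].
  by rewrite set_itv1 Rintegral_set1; ring.
pose F (x : R) : R := p * x + q / 2 * x ^+ 2 + r / 3 * x ^+ 3.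
have dF (x : R) : is_derive x 1 F (p + q * x + r * x ^+ 2).
  rewrite /F; apply: is_derive_eq.
  by rewrite -![_ *: _]/(_ * _) ; field.
have cF : continuous F.
  by move=> x; apply/differentiable_continuous/derivable1_diffP; have [] := dF x.
rewrite /Rintegral (@continuous_FTC2 _ _ F)//.
- by rewrite -EFinB /= /F; field.
- apply: continuous_subspaceT => x.
  apply: cvgD; [apply: cvgD|]; [exact: cvg_cst|apply: cvgM|apply: cvgM] => //;
   [exact: cvg_cst..|exact: exprn_continuous].
- split.
  + by move=> x _; have [] := dF x.
  + exact/cvg_at_right_filter/cF.
  + exact/cvg_at_left_filter/cF.
- by move=> x _; rewrite derive1E derive_val.
Qed.

(** * Cauchy-Schwarz for increments *)

(** [Phi] is the indefinite integral of [f'^2], extended by zero outside [[a, b]]. The periodic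
    estimates then need only [f] and [Phi]. *)
Lemma abs_cont_sqr_le (R : realType) (a b : R) (f f' : R -> R) :
  a <= b -> abs_cont_on a b f ->
  lebesgue_measure.-integrable `[a, b]
    (fun x => (f' x ^+ 2)%:E) ->
  {ae lebesgue_measure,
    forall x, `[a, b]%classic x -> is_derive x 1 f (f' x)} ->
  exists Phi : R -> R,
    [/\ {homo Phi : x y / x <= y},
        forall x y, a <= x -> x <= y -> y <= b ->
          (f y - f x) ^+ 2 <= (y - x) * (Phi y - Phi x) &
        Phi b - Phi a = \int[lebesgue_measure]_(x in `[a, b]) (f' x ^+ 2)].
Proof.
move=> ab acf intf' df.
pose mu : {measure set (measurableTypeR R) -> \bar R} := @lebesgue_measure R.
pose g (x : R) : R := f' x ^+ 2.
pose G : R -> R := g \_ `[a, b].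
have dfm : {ae mu, forall x, `[a, b]%classic x -> is_derive x 1 f (f' x)} by exact: df.
have mab : measurable `[a, b]%classic by exact: measurable_itv.
have G0 x : 0 <= G x.
  by rewrite /G patchE; case: ifP => // _; rewrite sqr_ge0.
have intG : mu.-integrable setT (EFin \o G).
  rewrite /G -restrict_EFin; apply/integrable_restrict => //=; rewrite setTI.
  exact: intf'.
have intGS (A : set R) : measurable A -> mu.-integrable A (EFin \o G).
  by move=> mA; apply: integrableS intG.
have locG : locally_integrable [set: R] G by exact: integrable_locally.
pose Phi (x : R) : R := \int[mu]_(t in `]-oo, x]) G t.
have PhiB x y : x <= y -> Phi y - Phi x = \int[mu]_(t in `]x, y]) G t.
  by move=> xy; rewrite Rintegral_itvB ?bnd_simp//; exact: intGS.
have Phi_homo : {homo Phi : x y / x <= y}.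
  by move=> x y xy; rewrite -subr_ge0 PhiB// Rintegral_ge0.
have dPhi : {ae mu, forall x, derivable Phi x 1 /\ derive1 Phi x = G x}.
  by apply: FTC1Ny => // y; exact: intGS.
(* [|f'| <= (lam f'^2 + 1 / lam) / 2]; optimising [lam] replaces Cauchy-Schwarz. *)
have young lam x y : 0 < lam -> a <= x -> x <= y -> y <= b ->
    `|f y - f x| <= lam / 2 * (Phi y - Phi x) + (y - x) / (2 * lam).
  move=> lam0 ax xy yb.
  pose F (z : R) : R := lam / 2 * Phi z + (2 * lam)^-1 * z.
  have -> : lam / 2 * (Phi y - Phi x) + (y - x) / (2 * lam) = F y - F x.
    by rewrite /F; ring.
  apply: abs_cont_comparison => //.
  - exact: (abs_cont_onS _ _ ax yb).
  - move=> s t _ st _; rewrite /F lerD// ler_wpM2l//; first by rewrite divr_ge0// ltW.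
      exact: Phi_homo.
    by rewrite invr_ge0 mulr_ge0// ltW.
  suff: {ae mu, forall t, x <= t <= y -> exists l L : R,
      [/\ is_derive t 1 f l, is_derive t 1 F L & `|l| <= L]} by [].
  apply: (@filterS2 _ _ (ae_filter_ringOfSetsType mu) _ _ _ _ dfm dPhi) => t dft [dPt PtG] /andP[xt ty].
  have tab : `[a, b]%classic t by rewrite /= in_itv/= (le_trans ax)// (le_trans ty).
  exists (f' t), (lam / 2 * G t + (2 * lam)^-1); split; first exact: dft.
  - have dP : is_derive t 1 Phi (G t) by split; rewrite // -PtG derive1E.
    rewrite /F; apply: is_derive_eq.
    by rewrite -![_ *: _]/(_ * _) mulr1.
  - have -> : G t = `|f' t| ^+ 2.
      by rewrite /G patchE mem_set// real_normK// num_real.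
    rewrite -subr_ge0.
    have -> : lam / 2 * `|f' t| ^+ 2 + (2 * lam)^-1 - `|f' t| =
      (lam * `|f' t| - 1) ^+ 2 / (2 * lam).
      by field; rewrite gt_eqF.
    by rewrite divr_ge0 ?sqr_ge0// mulr_ge0// ltW.
exists Phi; split => //.
- move=> x y ax xy yb; set d := f y - f x; set t := y - x.
  have [d0|dN0] := eqVneq d 0.
    by rewrite d0 expr0n/= mulr_ge0// subr_ge0//; exact: Phi_homo.
  have nd0 : 0 < `|d| by rewrite normr_gt0.
  have t0 : 0 < t.
    rewrite subr_gt0 lt_neqAle xy andbT; apply: contraNneq dN0 => exy.
    by rewrite /d exy subrr.
  (* With this [lam] the last term of [young] is [|d| / 2], which the left side absorbs; no division
     by the increment of [Phi], possibly zero, occurs. *)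
  have := young (t / `|d|) x y (divr_gt0 t0 nd0) ax xy yb.
  rewrite -/d -/t -(ler_pM2l nd0) => H.
  have -> : d ^+ 2 = `|d| * `|d| by rewrite -expr2 real_normK// num_real.
  have E : `|d| * (t / `|d| / 2 * (Phi y - Phi x) + t / (2 * (t / `|d|))) =
     t * (Phi y - Phi x) / 2 + `|d| * `|d| / 2.
    by field; rewrite !gt_eqF.
  by rewrite E in H; lra.
- rewrite PhiB// Rintegral_itv_obnd_cbnd; last exact: intGS.
  by apply: eq_Rintegral => x xab; rewrite /G patchE xab.
Qed.

(** * A Wirtinger inequality on the circle *)

Lemma continuous_dist_quadratic (R : realType) (c y : R) :
  continuous (fun x : R => c * `|x - y| - `|x - y| ^+ 2).
Proof.
have cn : continuous (fun x : R => `|x - y|).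
  move=> x; apply: (@cvg_norm _ _ _ _ _ (fun x => x - y)).
  by apply: cvgB; [exact: cvg_id|exact: cvg_cst].
move=> x; apply: cvgB; first by apply: cvgM; [exact: cvg_cst|exact: cn].
by apply: (@cvgM _ _ _ _ (fun x => `|x - y|) (fun x => `|x - y|)); exact: cn.
Qed.

(** The value is free of [y] because [t * (L - t)], with [L = b - a], is symmetric under
    [t -> L - t], hence rotation invariant on the circle of length [L]. *)
Lemma Rintegral_dist_quadratic (R : realType) (a b y : R) : a <= y -> y <= b ->
  \int[lebesgue_measure]_(x in `[a, b]) ((b - a) * `|x - y| - `|x - y| ^+ 2) =
  (b - a) ^+ 3 / 6.
Proof.
move=> ay yb.
pose w (x : R) : R := (b - a) * `|x - y| - `|x - y| ^+ 2.
have cw : continuous w by exact: continuous_dist_quadratic.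
have intw c d : lebesgue_measure.-integrable `[c, d] (EFin \o w).
  apply: continuous_compact_integrable; first exact: segment_compact.
  exact: continuous_subspaceT.
have wl : \int[lebesgue_measure]_(x in `[a, y]) w x =
    (b - a) * (y - a) ^+ 2 / 2 - (y - a) ^+ 3 / 3.
  transitivity (\int[lebesgue_measure]_(x in `[a, y])
    (((b - a) * y - y ^+ 2) + (2 * y - (b - a)) * x + (- 1) * x ^+ 2)).
    apply: eq_Rintegral => x; rewrite inE /= in_itv/= => /andP[_ xy].
    by rewrite /w ler0_norm ?subr_le0//; ring.
  by rewrite Rintegral_quadratic//; field.
have wr : \int[lebesgue_measure]_(x in `[y, b]) w x =
    (b - a) * (b - y) ^+ 2 / 2 - (b - y) ^+ 3 / 3.
  transitivity (\int[lebesgue_measure]_(x in `[y, b])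
    ((- ((b - a) * y) - y ^+ 2) + (2 * y + (b - a)) * x + (- 1) * x ^+ 2)).
    apply: eq_Rintegral => x; rewrite inE /= in_itv/= => /andP[yx _].
    by rewrite /w ger0_norm ?subr_ge0//; ring.
  by rewrite Rintegral_quadratic//; field.
have := @Rintegral_itvB _ w (BLeft a) (BRight b) y (intw a b).
rewrite !bnd_simp => /(_ ay yb).
rewrite Rintegral_itv_obnd_cbnd; last first.
  by apply: integrableS (intw y b) => //; exact: subset_itv_oc_cc.
rewrite wl wr => /eqP; rewrite subr_eq => /eqP ->.
by field.
Qed.

(** Two-term Cauchy-Schwarz, which joins the two pieces of the arc through the identified endpoints.
    It rests on [(s * v + t * u)^2 - 4 * s * u * t * v = (s * v - t * u)^2]. *)
Lemma sqr_addr_le (R : realDomainType) (x y s t u v : R) :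
  0 <= s -> 0 <= t -> 0 <= u -> 0 <= v ->
  x ^+ 2 <= s * u -> y ^+ 2 <= t * v ->
  (x + y) ^+ 2 <= (s + t) * (u + v).
Proof.
move=> s0 t0 u0 v0 xsu ytv.
have X0 : 0 <= s * v + t * u by rewrite addr_ge0// mulr_ge0.
suff : 2 * (x * y) <= s * v + t * u by lra.
rewrite leNgt; apply/negP => lt.
have : (s * v + t * u) ^+ 2 < (2 * (x * y)) ^+ 2 by rewrite ltrXn2r.
have : x ^+ 2 * y ^+ 2 <= (s * u) * (t * v) by rewrite ler_pM// sqr_ge0.
have := sqr_ge0 (s * v - t * u).
by lra.
Qed.

(* A chord of the circle of length [b - a] splits it into two arcs, and both
   give a bound on the increment of [f]. *)
Lemma periodic_sqr_le (R : realType) (a b : R) (f Phi : R -> R) (x y : R) :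
  {homo Phi : x y / x <= y} ->
  (forall x y, a <= x -> x <= y -> y <= b ->
     (f y - f x) ^+ 2 <= (y - x) * (Phi y - Phi x)) ->
  f a = f b -> a <= x <= b -> a <= y <= b ->
  (b - a) * (f x - f y) ^+ 2 <=
  (Phi b - Phi a) * ((b - a) * `|x - y| - `|x - y| ^+ 2).
Proof.
move=> Phi_homo fPhi fab; wlog xy : x y / x <= y.
  move=> H; have [xy|yx] := orP (le_total x y); first exact: H.
  by move=> xab yab; rewrite -sqrrN opprB distrC; exact: H.
move=> /andP[ax xb] /andP[ay yb].
rewrite ler0_norm ?subr_le0// opprB.
have H1 := fPhi _ _ ax xy yb.
have H2 : (f x - f y) ^+ 2 <=
    ((x - a) + (b - y)) * ((Phi x - Phi a) + (Phi b - Phi y)).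
  have -> : f x - f y = (f x - f a) + (f b - f y) by rewrite fab; ring.
  apply: sqr_addr_le; rewrite ?subr_ge0//; try exact: Phi_homo.
  - exact: fPhi.
  - exact: fPhi.
have H1' : (f x - f y) ^+ 2 <= (y - x) * (Phi y - Phi x).
  by rewrite -sqrrN opprB.
have s2 : 0 <= (x - a) + (b - y) by rewrite addr_ge0// subr_ge0.
have s1 : 0 <= y - x by rewrite subr_ge0.
(* Each arc's bound is weighted by the length of the other arc; the lengths sum to [b - a]. *)
have := ler_wpM2l s2 H1'; have := ler_wpM2l s1 H2.
by lra.
Qed.

(** The left side is the integral of [(f - m)^2], [m] being the mean. The constant [1/12] is not the
    sharp [1/(4 pi^2)], but at length [pi] anything below [1/pi^2] suffices. *)
Lemma periodic_wirtinger (R : realType) (a b : R) (f Phi : R -> R) :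
  a < b -> {within `[a, b], continuous f} -> {homo Phi : x y / x <= y} ->
  (forall x y, a <= x -> x <= y -> y <= b ->
     (f y - f x) ^+ 2 <= (y - x) * (Phi y - Phi x)) ->
  f a = f b ->
  \int[lebesgue_measure]_(x in `[a, b]) (f x ^+ 2)
    - (\int[lebesgue_measure]_(x in `[a, b]) f x) ^+ 2 / (b - a)
  <= (b - a) ^+ 2 / 12 * (Phi b - Phi a).
Proof.
move=> ab cf Phi_homo fPhi fab.
set L := b - a; set E := Phi b - Phi a.
have L0 : 0 < L by rewrite subr_gt0.
set S := \int[lebesgue_measure]_(x in `[a, b]) f x.
set Q := \int[lebesgue_measure]_(x in `[a, b]) (f x ^+ 2).
have cint (g : R -> R) : {within `[a, b], continuous g} ->
    lebesgue_measure.-integrable `[a, b] (EFin \o g).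
  by move=> cg; apply: continuous_compact_integrable => //; exact: segment_compact.
have cst_int (c : R) : \int[lebesgue_measure]_(x in `[a, b]) c = c * L.
  rewrite Rintegral_cst//; congr (_ * _).
  by have := lebesgue_measure_itv `[a, b]; rewrite /= lte_fin ab => ->.
have cfc (c : R) : {within `[a, b], continuous (fun x => f x - c)}.
  by move=> x; apply: cvgB; [exact: cf|exact: cvg_cst].
have cfc2 (c : R) : {within `[a, b], continuous (fun x => (f x - c) ^+ 2)}.
  by move=> x; apply: (cvgM (cfc c x) (cfc c x)).
have intc (c : R) : \int[lebesgue_measure]_(x in `[a, b]) (f x - c) ^+ 2 =
    Q - 2 * c * S + c ^+ 2 * L.
  have i2 : lebesgue_measure.-integrable `[a, b] (EFin \o (fun x => f x ^+ 2)).
    by apply: cint => x; apply: (cvgM (cf x) (cf x)).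
  have i1 : lebesgue_measure.-integrable `[a, b] (EFin \o (fun x => 2 * c * f x)).
    by apply: cint => x; apply: cvgM; [exact: cvg_cst|exact: cf].
  have i0 : lebesgue_measure.-integrable `[a, b] (EFin \o (fun=> c ^+ 2)).
    by apply: cint => x; exact: cvg_cst.
  rewrite -(cst_int (c ^+ 2)) /S /Q -RintegralZl//; last exact: cint.
  rewrite -RintegralB// -RintegralD//.
    by apply: eq_Rintegral => x _; ring.
  by apply: cint => x; apply: cvgB; [exact: cvgM (cf x) (cf x)|apply: cvgM; [exact: cvg_cst|exact: cf]].
pose m := S / L.
have [y yab ymax] := EVT_max (ltW ab) (cfc2 m).
have G1 : Q - 2 * m * S + m ^+ 2 * L <= (f y - m) ^+ 2 * L.
  rewrite -intc -cst_int; apply: le_Rintegral => //.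
  - by apply: cint; exact: cfc2.
  - by apply: cint => x; exact: cvg_cst.
have G2 : L * (Q - 2 * f y * S + f y ^+ 2 * L) <= E * (L ^+ 3 / 6).
  move: (yab); rewrite in_itv/= => /andP[ay yb].
  have cw : {within `[a, b], continuous (fun x : R => L * `|x - y| - `|x - y| ^+ 2)}.
    exact/continuous_subspaceT/continuous_dist_quadratic.
  rewrite -intc -(Rintegral_dist_quadratic _ _ _ _ ay yb) -!RintegralZl//; last 2 first.
  - exact: cint.
  - by apply: cint; exact: cfc2.
  apply: le_Rintegral => //.
  - by apply: cint => x; apply: cvgM; [exact: cvg_cst|exact: cfc2].
  - by apply: cint => x; apply: cvgM; [exact: cvg_cst|exact: cw].
  - by move=> x xab; apply: periodic_sqr_le => //; rewrite ay yb.
have SE : S = m * L by rewrite /m divfK// gt_eqF.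
rewrite SE; have -> : (m * L) ^+ 2 / L = m ^+ 2 * L by field; rewrite gt_eqF.
rewrite SE in G1 G2.
have {}G2 : Q - 2 * f y * (m * L) + f y ^+ 2 * L <= E * L ^+ 2 / 6.
  rewrite -(ler_pM2l L0); apply: (le_trans G2).
  by rewrite le_eqVlt; apply/orP; left; apply/eqP; field.
(* The integral in [G2] is [G + L * (f y - m)^2] with [G = Q - m^2 * L], hence at least [2 * G] by
   [G1]; this turns [1/6] into [1/12]. *)
lra.
Qed.

(** * Nonnegativity and the equality case *)

Theorem theorem3p2 (R : realType) (f f' : R -> R) :
  H1_0_with_deriv f f' ->
  0 <= 2 * (Rintegral lebesgue_measure (Delta R) f) ^+ 2
       - pi * Rintegral lebesgue_measure (Delta R)
                (fun x => f x ^+ 2 - f' x ^+ 2) /\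
  (2 * (Rintegral lebesgue_measure (Delta R) f) ^+ 2
       - pi * Rintegral lebesgue_measure (Delta R)
                (fun x => f x ^+ 2 - f' x ^+ 2) = 0 ->
   forall x, Delta R x -> f x = 0).
Proof.
move=> [[acf [_ [intf' df]]] fab].
have pi0 : 0 < (pi : R) := pi_gt0 R.
have ab : - (pi / 2) < pi / 2 :> R by lra.
have mD : measurable (Delta R) by exact: measurable_itv.
have {}intf' := lebesgue_integrable_sigma _ _ _ mD intf'.
have [Phi [Phi_homo fPhi PhiE]] := abs_cont_sqr_le _ _ _ _ _ (ltW ab) acf intf' df.
have cf := abs_cont_on_continuous _ _ _ _ acf.
have intf2 : lebesgue_measure.-integrable (Delta R) (EFin \o (fun x => f x ^+ 2)).
  apply: continuous_compact_integrable; first exact: segment_compact.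
  by move=> x; exact: cvgM (cf x) (cf x).
rewrite RintegralB//.
set S := Rintegral lebesgue_measure (Delta R) f.
set Q := Rintegral lebesgue_measure (Delta R) (fun x => f x ^+ 2).
set E := Rintegral lebesgue_measure (Delta R) (fun x => f' x ^+ 2).
have {}PhiE : Phi (pi / 2) - Phi (- (pi / 2)) = E by exact: PhiE.
have W : Q - S ^+ 2 / (pi / 2 - - (pi / 2)) <=
    (pi / 2 - - (pi / 2)) ^+ 2 / 12 * (Phi (pi / 2) - Phi (- (pi / 2))).
  exact: periodic_wirtinger.
have len : pi / 2 - - (pi / 2) = pi :> R by field.
rewrite PhiE len in W.
have E0 : 0 <= E by rewrite -PhiE subr_ge0; exact/Phi_homo/ltW.
have W' : pi * Q <= S ^+ 2 + pi * (pi ^+ 2 / 12 * E).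
  have -> : S ^+ 2 = pi * (S ^+ 2 / pi) by rewrite mulrCA divff ?mulr1// gt_eqF.
  by rewrite -mulrDr ler_pM2l// -lerBlDl.
have k0 : 0 < 1 - pi ^+ 2 / 12 :> R by have := pi_sqr_lt12 R; lra.
have S0 := sqr_ge0 S.
(* Both summands of the lower bound are nonnegative, so equality forces [S = 0] and [E = 0]. *)
have low : S ^+ 2 + pi * ((1 - pi ^+ 2 / 12) * E) <= 2 * S ^+ 2 - pi * (Q - E).
  by lra.
have kE0 : 0 <= pi * ((1 - pi ^+ 2 / 12) * E).
  by rewrite mulr_ge0// ?mulr_ge0// ltW.
split; first by apply: le_trans low; rewrite addr_ge0.
move=> eq0; rewrite eq0 in low.
have /eqP : S ^+ 2 = 0 by lra.
rewrite sqrf_eq0 => /eqP SE.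
have /eqP : pi * ((1 - pi ^+ 2 / 12) * E) = 0 by lra.
rewrite !mulf_eq0 (gt_eqF pi0) (gt_eqF k0) /= => /eqP EE x xD.
(* With [E = 0] the two-arc bound makes [f] constant at every point, not just almost everywhere;
   [S = 0] then makes the constant zero. *)
have fc y : Delta R y -> f y = f x.
  move: xD; rewrite /Delta /= !in_itv/= => xD yD.
  have := periodic_sqr_le _ _ _ _ _ _ _ Phi_homo fPhi fab yD xD.
  rewrite PhiE EE mul0r pmulr_rle0; last by lra.
  move=> le0; apply/eqP; rewrite -subr_eq0 -sqrf_eq0.
  by rewrite eq_le le0 sqr_ge0.
have : S = f x * pi.
  transitivity (Rintegral lebesgue_measure (Delta R) (fun=> f x)).
    by apply: eq_Rintegral => y /set_mem; exact: fc.
  rewrite Rintegral_cst//; congr (_ * _).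
  have := lebesgue_measure_itv `[- (pi / 2), pi / 2 : R].
  rewrite /= lte_fin ab -EFinB => ->; rewrite /=; lra.
by rewrite SE => /esym/eqP; rewrite mulf_eq0 (gt_eqF pi0) orbF => /eqP.
Qed.
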